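(* Let $k$ be a positive integer and let $\Lambda$ be a finitely aligned (discrete) $k$-graph. Then the path groupoid of graph morphisms $G_{\Lambda,\mathrm m}$ (for $(Q,P)=(\mathbb Z^k,\mathbb N^k)$) and Yeend's path groupoid $G_{\Lambda,\mathrm{Yee}}$ are equal as topological groupoids: they have the same underlying set, the same groupoid operations and the same topology. Consequently the boundary-path groupoids $\partial G_{\Lambda,\mathrm m}$ and $\partial G_{\Lambda,\mathrm{Yee}}$ are also equal as topological groupoids.
   Context: $k$-graphs. A $k$-graph is a countable small category $\Lambda$ (identified with its set of morphisms; units $\Lambda^{(0)}$, range $\mathbf r$, source $\mathbf s$, $\lambda\mu$ defined iff $\mathbf s(\lambda)=\mathbf r(\mu)$) with a functor $\mathbf d\colon\Lambda\to\mathbb N^k$ satisfying unique factorisation: if $\mathbf d(\lambda)=m+n$, there are unique $\mu,\nu$ with $\lambda=\mu\nu$, $\mathbf d(\mu)=m$, $\mathbf d(\nu)=n$. Write $\mu\Lambda=\{\mu\nu : \mathbf s(\mu)=\mathbf r(\nu)\}$. $\Lambda$ is finitely aligned if for all $\mu,\nu$ there is a finite $J\subseteq\Lambda$ with $\mu\Lambda\cap\nu\Lambda=\bigcup_{\lambda\in J}\lambda\Lambda$. A graph morphism is a degree-preserving functor. $\le$ is the coordinatewise order. A set $E\subseteq\Lambda$ is exhaustive if for all $\lambda\in\Lambda$ with $\mathbf r(\lambda)\in\mathbf r(E)$ there is $\mu\in E$ with $\lambda\Lambda\cap\mu\Lambda\ne\emptyset$. The groupoid $G_{\Lambda,\mathrm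 m}$. For $m\in\mathbb N^k$ let $\Omega_{\mathbb N^k,m}=\{(p,q)\in\mathbb N^k\times\mathbb N^k : p\le q\le m\}$, with $(p,q)(q,r)=(p,r)$ and degree $q-p$; for a $\le$-increasing sequence $(m_n)$ in $\mathbb N^k$ let $\Omega_{\mathbb N^k,(m_n)}=\bigcup_n\Omega_{\mathbb N^k,m_n}$. $X_{\Lambda,\mathrm m}$ is the set of graph morphisms $x\colon\Omega_{\mathbb N^k,(m_n)}\to\Lambda$ with $(m_n)$ $\le$-increasing; $\mathrm{dom}(x)$ is the domain of $x$. It has the topology with basis $\{x : K_1\subseteq \{x(0,q):(0,q)\in\mathrm{dom}(x)\}\subseteq\Lambda\setminus K_2\}$, $K_1,K_2\subseteq\Lambda$ finite. For $(0,m)\in\mathrm{dom}(x)$, $x\cdot m$ is the graph morphism with $(p,q)\in\mathrm{dom}(x\cdot m)\iff(m+p,m+q)\in\mathrm{dom}(x)$ and $(x\cdot m)(p,q)=x(m+p,m+q)$. $G_{\Lambda,\mathrm m}$ is the set of $(x,q,y)\in X_{\Lambda,\mathrm m}\times\mathbb Z^k\times X_{\Lambda,\mathrm m}$ for which there are $m,n\in\mathbb N^k$ with $q=m-n$, $(0,m)\in\mathrm{dom}(x)$, $(0,n)\in\mathrm{dom}(y)$ and $x\cdot m=y\cdot n$; with $(x,q,y)(y,r,z)=(x,q+r,z)$, $(x,q,y)^{-1}=(y,-q,x)$, and topology with basis $\{(x,m-n,y)\in G_{\Lambda,\mathrm m} : x\in U,\ y\in V,\ x\cdot m=y\cdot n\}$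 for $m,n\in\mathbb N^k$ and $U,V\subseteq X_{\Lambda,\mathrm m}$ open. The groupoid $G_{\Lambda,\mathrm{Yee}}$. For $m\in(\mathbb N\cup\{\infty\})^k$ let $\Omega_{k,m}=\{(p,q)\in\mathbb N^k\times\mathbb N^k : p\le q\le m\}$ with the same operations. $X_{\Lambda,\mathrm{Yee}}$ is the set of graph morphisms $x\colon\Omega_{k,m}\to\Lambda$, $m\in(\mathbb N\cup\{\infty\})^k$; write $\mathbf d(x)=m$. For $p\in\mathbb N^k$ with $p\le\mathbf d(x)$, $\sigma^px$ is the unique graph morphism with domain $\Omega_{k,\mathbf d(x)-p}$ and $(\sigma^px)(0,q)=x(p,p+q)$ for all $q\in\mathbb N^k$ with $q\le\mathbf d(x)-p$. For $\lambda\in\Lambda$ with $\mathbf s(\lambda)=x(0,0)$, $\lambda x$ is the unique graph morphism with domain $\Omega_{k,\mathbf d(\lambda)+\mathbf d(x)}$ such that $(\lambda x)(0,\mathbf d(\lambda))=\lambda$ and $\sigma^{\mathbf d(\lambda)}(\lambda x)=x$. $G_{\Lambda,\mathrm{Yee}}$ is the set of triples $(x,m,y)\in X_{\Lambda,\mathrm{Yee}}\times\mathbb Z^k\times X_{\Lambda,\mathrm{Yee}}$ for which there are $p,q\in\mathbb N^k$ with $p\le\mathbf d(x)$, $q\le\mathbf d(y)$, $m=p-q$ and $\sigma^px=\sigma^qy$, with operations $(x,m,y)(y,n,z)=(x,m+n,z)$ and $(x,m,y)^{-1}=(y,-m,x)$. For $A,B\subseteq\Lambda$ let $A*_{\mathbf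 s}B=\{(\lambda,\mu)\in A\times B : \mathbf s(\lambda)=\mathbf s(\mu)\}$. For $m\in\mathbb Z^k$ and $F\subseteq\Lambda*_{\mathbf s}\Lambda$ let $Z_{\mathrm{Yee}}(F,m)$ be the set of all $(\lambda x,\mathbf d(\lambda)-\mathbf d(\mu),\mu x)$ with $(\lambda,\mu)\in F$, $\mathbf d(\lambda)-\mathbf d(\mu)=m$, $x\in X_{\Lambda,\mathrm{Yee}}$ and $x(0,0)=\mathbf s(\lambda)$. The topology of $G_{\Lambda,\mathrm{Yee}}$ has as basis the sets $Z_{\mathrm{Yee}}(A*_{\mathbf s}B,m)\setminus Z_{\mathrm{Yee}}(F,m)$ for $m\in\mathbb Z^k$, $A,B\subseteq\Lambda$ and finite $F\subseteq\Lambda*_{\mathbf s}\Lambda$. Boundary-path groupoids. $\partial\Lambda_{\mathrm m}$ (respectively $\partial\Lambda_{\mathrm{Yee}}$) is the set of $x$ in $X_{\Lambda,\mathrm m}$ (respectively $X_{\Lambda,\mathrm{Yee}}$) such that, whenever $(0,m)\in\mathrm{dom}(x)$ and $E\subseteq\Lambda$ is finite, exhaustive and $\mathbf s(x(0,m))\in\mathbf r(E)$, there is $\nu\in E$ with $x(m,m+\mathbf d(\nu))=\nu$. $\partial G_{\Lambda,\mathrm m}$ and $\partial G_{\Lambda,\mathrm{Yee}}$ are the sets of those $(x,q,y)$ in $G_{\Lambda,\mathrm m}$ and $G_{\Lambda,\mathrm{Yee}}$, respectively, with $x$ and $y$ in $\partial\Lambda_{\mathrm m}$, respectively $\partial\Lambda_{\mathrm{Yee}}$,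 with the subspace topologies. *)

(* Defs.v *)
From HB Require Import structures.
From mathcomp Require Import all_boot all_order all_algebra.
From mathcomp Require Import boolp classical_sets functions cardinality.

Set Implicit Arguments.
Unset Strict Implicit.
Unset Printing Implicit Defensive.

Import GRing.Theory.
Local Open Scope classical_set_scope.
Local Open Scope ring_scope.

(* The monoid N^k, the group Z^k, and the set (N u {oo})^k, in which a
   coordinate None stands for oo. *)
Notation Nk k := {ffun 'I_k -> nat}.
Notation Zk k := {ffun 'I_k -> int}.
Notation Nook k := {ffun 'I_k -> option nat}.

Section Degrees.
Variable k : nat.
Implicit Types (p q : Nk k) (m : Nook k).

(* Truncated subtraction, only ever used when q <= p. *)
Definition subNk p q : Nk k := [ffun i => (p i - q i)%N].

Definition leNk p q : Prop := forall i, (p i <= q i)%N.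

Definition diffZk p q : Zk k := [ffun i => (p i)%:Z - (q i)%:Z].

Definition leNook p m : Prop :=
  forall i, if m i is Some a then (p i <= a)%N else true.

Definition addNook p m : Nook k := [ffun i => omap (addn (p i)) (m i)].

(* m - p, with oo - n = oo; only ever used when p <= m. *)
Definition subNook m p : Nook k := [ffun i => omap (subn^~ (p i)) (m i)].

End Degrees.

(* A k-graph, identified with its set of morphisms: an object is identified
   with its identity morphism, so [rng] and [src] take values in the units.
   The value of [comp l m] is meaningless unless [src l = rng m]. *)
Record kgraph (k : nat) : Type := KGraph {
  mor :> Type;
  rng : mor -> mor;
  src : mor -> mor;
  comp : mor -> mor -> mor;
  deg : mor -> Nk k;
  mor_countable : countable [set: mor];
  rng_rng : forall l, rng (rng l) = rng l;
  src_rng : forall l, src (rng l) = rng l;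
  rng_src : forall l, rng (src l) = src l;
  src_src : forall l, src (src l) = src l;
  rng_comp : forall l m, src l = rng m -> rng (comp l m) = rng l;
  src_comp : forall l m, src l = rng m -> src (comp l m) = src m;
  comp_idl : forall l, comp (rng l) l = l;
  comp_idr : forall l, comp l (src l) = l;
  compA : forall l m n, src l = rng m -> src m = rng n ->
    comp (comp l m) n = comp l (comp m n);
  deg_rng : forall l, deg (rng l) = 0;
  deg_src : forall l, deg (src l) = 0;
  deg_comp : forall l m, src l = rng m ->
    deg (comp l m) = deg l + deg m;
  unique_factorisation : forall l (m n : Nk k), deg l = m + n ->
    exists! mn : mor * mor, [/\ src mn.1 = rng mn.2, l = comp mn.1 mn.2,
      deg mn.1 = m & deg mn.2 = n]
}.

Section KGraphs.
Variables (k : nat) (L : kgraph k).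
Implicit Types (l mu nu : L) (E J : set L).

Definition principal mu : set L :=
  [set comp mu nu | nu in [set nu | src mu = rng nu]].

Definition finitely_aligned : Prop := forall mu nu, exists J,
  finite_set J /\
  principal mu `&` principal nu = \bigcup_(l in J) principal l.

Definition exhaustive E : Prop := forall l, (@rng k L @` E) (rng l) ->
  exists2 mu, E mu & principal l `&` principal mu !=set0.

End KGraphs.

Section Domains.
Variable k : nat.

Definition Omega_fin (m : Nk k) : set (Nk k * Nk k) :=
  [set pq | leNk pq.1 pq.2 /\ leNk pq.2 m].

Definition increasing (ms : nat -> Nk k) : Prop :=
  forall i j, (i <= j)%N -> leNk (ms i) (ms j).

Definition Omega_seq (ms : nat -> Nk k) : set (Nk k * Nk k) :=
  \bigcup_n Omega_fin (ms n).

Definition Omega_oo (m : Nook k) : set (Nk k * Nk k) :=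
  [set pq | leNk pq.1 pq.2 /\ leNook pq.2 m].

End Domains.

(* The ambient type of the paths: a function whose domain is a subset of
   N^k x N^k is encoded by a total function to [option L]; two paths are equal
   iff they have the same domain and the same values on it. *)
Definition kpath (k : nat) (L : kgraph k) := Nk k * Nk k -> option L.

Section Paths.
Variables (k : nat) (L : kgraph k).
Implicit Types (x y : kpath L) (l : L) (p q r m n : Nk k).

Definition dom x : set (Nk k * Nk k) := [set pq | exists l, x pq = Some l].

(* [x] is a degree-preserving functor from D to L, where in the category D the
   arrow (p, q) has range p = (p, p), source q = (q, q) and degree q - p, and
   (p, q)(q, r) = (p, r). *)
Definition graph_morphism (D : set (Nk k * Nk k)) x : Prop :=
  [/\ dom x = D,
      forall p q l, x (p, q) = Some l -> deg l = subNk q p,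
      forall p q l, x (p, q) = Some l ->
        x (p, p) = Some (rng l) /\ x (q, q) = Some (src l)
    & forall p q r l l', x (p, q) = Some l -> x (q, r) = Some l' ->
        x (p, r) = Some (comp l l')].

Definition X_m : set (kpath L) :=
  [set x | exists2 ms, increasing ms & graph_morphism (Omega_seq ms) x].

Definition X_Yee : set (kpath L) :=
  [set x | exists m : Nook k, graph_morphism (Omega_oo m) x].

Definition boundary (X : set (kpath L)) : set (kpath L) :=
  [set x | X x /\ forall m l E, x (0, m) = Some l ->
     finite_set E -> exhaustive E -> (@rng k L @` E) (src l) ->
     exists2 nu, E nu & x (m, m + deg nu) = Some nu].

End Paths.

Definition topology_with_basis (T : Type) (B : set (set T)) : set (set T) :=
  [set \bigcup_(U in C) U | C in subset^~ B].

(* The data of a topological groupoid whose elements are taken from the type T: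
   the underlying set, the graphs of the partially defined multiplication
   (g, h) |-> gh and of the inversion g |-> g^-1, and the set of open sets.
   Equality in this type is equality of all four components. *)
Record tgroupoid (T : Type) : Type := TGroupoid {
  gset : set T;
  gmul : set (T * T * T);
  ginv : set (T * T);
  gopen : set (set T)
}.

Definition subgroupoid (T : Type) (G : tgroupoid T) (H : set T) : tgroupoid T :=
  {| gset := gset G `&` H;
     gmul := [set t | [/\ gmul G t, H t.1.1, H t.1.2 & H t.2]];
     ginv := [set t | [/\ ginv G t, H t.1 & H t.2]];
     gopen := [set U `&` (gset G `&` H) | U in gopen G] |}.

Section PathGroupoids.
Variables (k : nat) (L : kgraph k).
Implicit Types (x y z : kpath L) (l mu : L) (p m n : Nk k) (q r : Zk k).

Definition triple : Type := kpath L * Zk k * kpath L.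

Definition triple_mul (G : set triple) : set (triple * triple * triple) :=
  [set t | exists x q y r z, [/\ G (x, q, y), G (y, r, z)
     & t = ((x, q, y), (y, r, z), (x, q + r, z))]].

Definition triple_inv (G : set triple) : set (triple * triple) :=
  [set t | exists x q y, G (x, q, y) /\ t = ((x, q, y), (y, - q, x))].

Definition boundary_triples (X : set (kpath L)) : set triple :=
  [set g | boundary X g.1.1 /\ boundary X g.2].

Definition X_m_open : set (set (kpath L)) := topology_with_basis
  [set Z | exists K1 K2 : set L, [/\ finite_set K1, finite_set K2
     & Z = [set x | [/\ X_m x,
              K1 `<=` [set l | exists m, x (0, m) = Some l]
            & [set l | exists m, x (0, m) = Some l] `<=` ~` K2]]]].

(* x . m *)
Definition shift x m : kpath L := fun pq => x (m + pq.1, m + pq.2).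

Definition G_m_set : set triple :=
  [set g | exists x y m n, [/\ g = (x, diffZk m n, y), X_m x /\ X_m y,
     dom x (0, m), dom y (0, n) & shift x m = shift y n]].

Definition G_m_basis : set (set triple) :=
  [set Z | exists m n (U V : set (kpath L)), [/\ X_m_open U, X_m_open V
     & Z = [set g | exists x y, [/\ g = (x, diffZk m n, y),
              G_m_set g, U x /\ V y,
              dom x (0, m) /\ dom y (0, n)
            & shift x m = shift y n]]]].

Definition G_m : tgroupoid triple :=
  {| gset := G_m_set;
     gmul := triple_mul G_m_set;
     ginv := triple_inv G_m_set;
     gopen := topology_with_basis G_m_basis |}.

Definition boundary_G_m : tgroupoid triple :=
  subgroupoid G_m (boundary_triples (@X_m k L)).

(* d(x), that is, the m such that the domain of x is Omega_{k,m} *)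
Definition deg_Yee x : Nook k :=
  xget [ffun => None] [set m : Nook k | dom x = Omega_oo m].

(* "The unique path such that P"; it is the nowhere defined path when no path
   satisfies P. [{classic _}] only serves to make choice available. *)
Definition the_path (P : set (kpath L)) : kpath L :=
  @xget {classic kpath L} (fun=> None) P.

(* sigma^p x *)
Definition sigma p x : kpath L := the_path
  [set y | graph_morphism (Omega_oo (subNook (deg_Yee x) p)) y /\
     forall n, leNook n (subNook (deg_Yee x) p) ->
       y (0, n) = x (p, p + n)].

(* l x *)
Definition concat l x : kpath L := the_path
  [set y | [/\ graph_morphism (Omega_oo (addNook (deg l) (deg_Yee x))) y,
     y (0, deg l) = Some l & sigma (deg l) y = x]].

Definition G_Yee_set : set triple :=
  [set g | exists x y m n, [/\ g = (x, diffZk m n, y), X_Yee x /\ X_Yee y,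
     leNook m (deg_Yee x), leNook n (deg_Yee y) & sigma m x = sigma n y]].

(* A *_s B *)
Definition fibre_prod (A B : set L) : set (L * L) :=
  [set lm | [/\ A lm.1, B lm.2 & src lm.1 = src lm.2]].

Definition Z_Yee (F : set (L * L)) q : set triple :=
  [set g | exists l mu x, [/\ F (l, mu), diffZk (deg l) (deg mu) = q,
     X_Yee x, x (0, 0) = Some (src l)
   & g = (concat l x, diffZk (deg l) (deg mu), concat mu x)]].

Definition G_Yee_basis : set (set triple) :=
  [set Z | exists q (A B : set L) (F : set (L * L)),
     [/\ finite_set F, F `<=` fibre_prod setT setT
       & Z = Z_Yee (fibre_prod A B) q `\` Z_Yee F q]].

Definition G_Yee : tgroupoid triple :=
  {| gset := G_Yee_set;
     gmul := triple_mul G_Yee_set;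
     ginv := triple_inv G_Yee_set;
     gopen := topology_with_basis G_Yee_basis |}.

Definition boundary_G_Yee : tgroupoid triple :=
  subgroupoid G_Yee (boundary_triples (@X_Yee k L)).

End PathGroupoids.

(* Main.v *)
Require Import Defs.
From mathcomp Require Import all_boot.
From mathcomp Require Import all_order all_algebra.
From mathcomp Require Import boolp classical_sets functions cardinality.
From mathcomp Require Import zify.
(* [comp] again denotes the composition of a k-graph, not that of ssrfun. *)
Import Defs.

Set Implicit Arguments.
Unset Strict Implicit.
Unset Printing Implicit Defensive.

Import GRing.Theory.
Local Open Scope classical_set_scope.
Local Open Scope ring_scope.

(* By unique factorisation a path is determined by its initial segments x(0,q),
   so sigma^p is the shift and the two path spaces coincide; the degree of a path
   is the supremum of the sequence (m_n). A triple lies in Z_Yee(F,q) iff its two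
   paths begin with l and mu for some (l,mu) in F and agree afterwards. To refine
   a basic set of G_m, extend x(0,m) and y(0,n) by a common r until all prefixes
   required by K_1 are covered; the prefixes forbidden by K_2 are excluded by
   removing finitely many pairs (l nu, mu nu), by finite alignment. Conversely,
   (x,q,y) is separated from a pair (a,b) in F by forbidding a or b as a prefix,
   or, if x and y do begin with a and b, by fixing x and y far enough that their
   disagreement after a and b is visible. *)

(** * Degrees, their joins and the domains of paths *)

Definition joinNk k (p q : Nk k) : Nk k := [ffun i => maxn (p i) (q i)].

Definition leq_oo (a : nat) (o : option nat) : bool :=
  if o is Some b then (a <= b)%N else true.

(** Statements about degrees are proved one coordinate at a time: hypotheses on degrees are
    specialised to that coordinate, values in [option nat] are split into finite and infinite, and
    linear arithmetic remains. *)
Ltac degrees :=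
  lazymatch goal with
  | |- @eq _ _ _ => apply/ffunP
  | |- _ => idtac
  end;
  let i := fresh "i" in move=> i;
  repeat match goal with
  | H : leNk _ _ |- _ => move: (H i); clear H
  | H : leNook _ _ |- _ => move: (H i); clear H
  | H : @eq _ _ _ |- _ => move/ffunP/(_ i): H
  end;
  rewrite /joinNk /subNk /subNook /addNook /diffZk ?ffunE /=;
  repeat match goal with
  | |- context [omap _ ?t] =>
      let a := fresh "a" in case: t => [a|] /=
  | |- context [match ?t with Some _ => _ | None => _ end] =>
      let a := fresh "a" in case: t => [a|] /=
  end;
  intros; lia.

Section Degrees.
Variable k : nat.
Implicit Types (p q r : Nk k) (m n : Nook k).

Lemma le0Nk p : leNk 0 p. Proof. degrees. Qed.

Lemma leNk_refl p : leNk p p. Proof. degrees. Qed.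

Lemma leNk_trans q p r : leNk p q -> leNk q r -> leNk p r.
Proof. move=> pq qr; degrees. Qed.

Lemma leNook_trans q p m : leNk p q -> leNook q m -> leNook p m.
Proof. move=> pq qm; degrees. Qed.

Lemma leNk_addr p q : leNk p (p + q). Proof. degrees. Qed.

Lemma addNk_sub p q : leNk p q -> p + subNk q p = q.
Proof. move=> pq; degrees. Qed.

Lemma addNkI p q r : p + q = p + r -> q = r.
Proof. move=> e; degrees. Qed.

Lemma leNk_joinl p q : leNk p (joinNk p q). Proof. degrees. Qed.
Lemma leNk_joinr p q : leNk q (joinNk p q). Proof. degrees. Qed.

Lemma leNook_join p q m : leNook p m -> leNook q m -> leNook (joinNk p q) m.
Proof. move=> pm qm; degrees. Qed.

Lemma leNook_sub p q m : leNook p m -> leNook q (subNook m p) <-> leNook (p + q) m.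
Proof. by move=> pm; split=> qm; degrees. Qed.

Lemma diffZk_eq p q p' q' :
  diffZk p q = diffZk p' q' <-> p + q' = p' + q.
Proof. by split=> e; degrees. Qed.

Lemma Omega_oo_inj m n : Omega_oo m = Omega_oo n -> m = n.
Proof.
move=> e; apply/ffunP=> i.
have key a : leq_oo a (m i) = leq_oo a (n i).
  (* Testing with [a] at coordinate [i] and zero elsewhere isolates that coordinate. *)
  pose p : Nk k := [ffun j => if j == i then a else 0%N].
  have le u : leNook p u <-> leq_oo a (u i).
    split=> [/(_ i)|h j]; first by rewrite ffunE eqxx; case: (u i).
    by rewrite ffunE; case: eqP => [->|_]; [move: h; case: (u i)|case: (u j)].
  have lemn : leNook p m <-> leNook p n.
    have lemn u : leNook p u <-> Omega_oo u (0, p).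
      by split=> [?|[]//]; split=> //; exact: le0Nk.
    by rewrite !lemn e.
  by apply/idP/idP => h; [apply/(le n)/lemn/(le m)|apply/(le m)/lemn/(le n)].
case: (m i) (n i) key => [a|] [b|] // key; first 1 last.
(* A finite coordinate [a] differs from an infinite one at the test value [a.+1]. *)
- by have := key a.+1; rewrite /leq_oo ltnn.
- by have := key b.+1; rewrite /leq_oo ltnn.
- by congr Some; have := key a; have := key b; rewrite /leq_oo; lia.
Qed.

(** The degree [m] is the coordinatewise supremum of the sequence, infinite where the sequence is
    unbounded. *)
Lemma Omega_seq_oo (ms : nat -> Nk k) : increasing ms ->
  exists m, Omega_seq ms = Omega_oo m.
Proof.
move=> inc.
have sup (i : 'I_k) : exists o : option nat, forall a,
    (exists j, (a <= ms j i)%N) <-> leq_oo a o.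
  case: (pselect (exists b, forall j, (ms j i <= b)%N)) => [bnd|unb].
    have [b bP bmin] : exists2 b, (forall j, (ms j i <= b)%N) &
        forall c, (forall j, (ms j i <= c)%N) -> (b <= c)%N.
      have bnd' : exists b, `[< forall j, (ms j i <= b)%N >].
        by have [b bP] := bnd; exists b; apply/asboolP.
      exists (ex_minn bnd').
        by case: ex_minnP => b /asboolP.
      by case: ex_minnP => b _ h c cP; apply/h/asboolP.
    exists (Some b) => a; split=> [[j]|ab].
      by move/leq_trans; apply.
    apply: contrapT => /forallNP h.
    case: a ab h => [|a] ab h; first by apply: (h 0%N).
    suff : (b <= a)%N by rewrite leqNgt (ab : (a < b)%N).
    by apply: bmin => j; have := h j; lia.
  exists None => a; split=> // _; apply: contrapT => /forallNP h.
  by apply: unb; exists a => j; have := h j; lia.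
have [f fP] := choice sup.
exists [ffun i => f i]; apply/seteqP; split=> -[p q] /=.
  move=> [n _ [pq qn]]; split=> // i; rewrite ffunE.
  by have /fP : exists j, (q i <= ms j i)%N by [exists n]; case: (f i).
move=> [pq qf].
have qf' i : exists j, (q i <= ms j i)%N.
  by apply/fP; have := qf i; rewrite ffunE; case: (f i).
have [g gP] := choice qf'.
(* Each coordinate is dominated from some index on; as there are finitely many coordinates and the
   sequence increases, the largest index serves for all. *)
exists (\max_i g i)%N => //; split=> // i.
by apply: leq_trans (gP i) _; apply: inc; exact: leq_bigmax.
Qed.

(** Finite coordinates are kept constant and infinite ones replaced by the index [j]. *)
Lemma Omega_oo_seq m : exists2 ms, increasing ms & Omega_seq ms = Omega_oo m.
Proof.
exists (fun j => [ffun i => if m i is Some a then a else j]).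
  by move=> i j ij l; rewrite !ffunE; case: (m l).
apply/seteqP; split=> -[p q] /=.
  move=> [n _ [pq qn]]; split=> // i; move: (qn i); rewrite ffunE.
  by case: (m i).
move=> [pq qm]; exists (\max_i q i)%N => //; split=> // i.
rewrite ffunE; have := qm i; case: (m i) => // _.
exact: leq_bigmax.
Qed.

Lemma finite_sup m (D : set (Nk k)) : finite_set D ->
  (forall p, D p -> leNook p m) ->
  exists2 r, leNook r m & forall p, D p -> leNk p r.
Proof.
move=> /finite_seqP[s ->] sm.
exists [ffun i => \max_(p <- s) p i]%N => [i|p ps i]; rewrite ffunE.
  case mi: (m i) => [a|//]; apply/bigmax_leqP_seq => p ps _.
  by have := sm p ps i; rewrite mi.
exact: (leq_bigmax_seq (P := xpredT) (F := fun p : Nk k => p i) p ps).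
Qed.

End Degrees.

(** * Unique factorisation and the prefix order *)

Section Factorisation.
Variables (k : nat) (L : kgraph k).
Implicit Types (l mu nu a b c : L).

Lemma factor_inj a b a' b' : src a = rng b -> src a' = rng b' ->
  deg a = deg a' -> comp a b = comp a' b' -> a = a' /\ b = b'.
Proof.
move=> ab ab' da e.
have db : deg b = deg b'.
  by apply: (@addNkI _ (deg a)); rewrite {2}da -!deg_comp // e.
have [uv [_ uniq]] := unique_factorisation (deg_comp ab).
have eab : uv = (a, b) by exact: uniq.
have : uv = (a', b') by apply: uniq; split.
by rewrite eab => -[-> ->].
Qed.

Lemma factor_ex l p : leNk p (deg l) ->
  exists a b, [/\ src a = rng b, l = comp a b & deg a = p].
Proof.
move=> /addNk_sub/esym/unique_factorisation[[a b] [[/= sab lab da _] _]].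
by exists a, b.
Qed.

(** Both [comp (rng l) l] and [comp l (src l)] factorise [l] with a first factor of degree 0, so the
    first factors agree. *)
Lemma deg0_rng l : deg l = 0 -> rng l = l.
Proof.
move=> dl; have [||||-> //] := @factor_inj (rng l) l l (src l).
- exact: src_rng.
- by rewrite rng_src.
- by rewrite deg_rng dl.
- by rewrite comp_idl comp_idr.
Qed.

Lemma principal_refl a : principal a a.
Proof. by exists (src a); rewrite /= ?comp_idr // rng_src. Qed.

Lemma principal_comp a b : src a = rng b -> principal a (comp a b).
Proof. by move=> ab; exists b. Qed.

Lemma principal_trans b a c : principal a b -> principal b c -> principal a c.
Proof.
move=> [u /= au <-] [v /= buv <-].
rewrite src_comp // in buv.
by exists (comp u v) => /=; rewrite ?rng_comp // compA.
Qed.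

Lemma principal_deg a b : principal a b -> leNk (deg a) (deg b).
Proof. by move=> [u /= au <-]; rewrite deg_comp //; exact: leNk_addr. Qed.

(** The prefix of [b] of degree [deg a] is also a prefix of [l], hence equals [a]. *)
Lemma principal_total a b l : principal a l -> principal b l ->
  leNk (deg a) (deg b) -> principal a b.
Proof.
move=> [u /= au <-] [v /= bv]; move=> e /factor_ex[a' [w [aw bE da]]].
move: bv e; rewrite bE src_comp // => wv; rewrite compA // => e.
have aw' : src a' = rng (comp w v) by rewrite rng_comp.
have [<- _] := factor_inj aw' au da e.
exact: principal_comp.
Qed.

Lemma principal_anti a b l : principal a l -> principal b l ->
  deg a = deg b -> a = b.
Proof.
move=> [u /= au e1] [v /= bv e2] dab.
by have [] := factor_inj au bv dab (etrans e1 (esym e2)).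
Qed.

Lemma prefix_ex l p : leNk p (deg l) -> exists2 a, principal a l & deg a = p.
Proof.
by move=> /factor_ex[a [b [ab -> <-]]]; exists a => //; exact: principal_comp.
Qed.

End Factorisation.

(** * Path spaces, initial segments and shifts *)

Section Paths.
Variables (k : nat) (L : kgraph k).
Implicit Types (x y z : kpath L) (l mu a b c : L) (p q r n : Nk k) (m : Nook k).

Lemma Omega_oo0 m p : Omega_oo m (0, p) <-> leNook p m.
Proof. by split=> [[]//|pm]; split=> //; exact: le0Nk. Qed.

Lemma X_m_Yee : @X_m k L = @X_Yee k L.
Proof.
apply/seteqP; split=> x.
  by move=> [ms /Omega_seq_oo[m ->]]; exists m.
by move=> [m xm]; have [ms ? msm] := Omega_oo_seq m; exists ms; rewrite ?msm.
Qed.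

(** The value at [(p, q)] has to be the [l] with [comp (f p) l = f q]; it is unique by cancellation,
    and functoriality follows from associativity. *)
Lemma path_of_prefixes m (f : Nk k -> L) :
  (forall p, leNook p m -> deg (f p) = p) ->
  (forall p q, leNk p q -> leNook q m -> principal (f p) (f q)) ->
  exists2 x, graph_morphism (Omega_oo m) x
           & forall p, leNook p m -> x (0, p) = Some (f p).
Proof.
move=> df pf.
pose R p q l := src (f p) = rng l /\ comp (f p) l = f q.
have Runiq p q l l' : R p q l -> R p q l' -> l = l'.
  by move=> [h1 e1] [h2 e2]; have [] := factor_inj h1 h2 erefl (etrans e1 (esym e2)).
have /choice[x xP] : forall pq, exists o, forall l, o = Some l <->
    Omega_oo m pq /\ R pq.1 pq.2 l.
  move=> [p q]; case: (pselect (Omega_oo m (p, q))) => pqm; last first.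
    by exists None => l; split=> // -[].
  have [/= pq qm] := pqm; have [l /= h1 h2] := pf _ _ pq qm.
  exists (Some l) => l'; split=> [[<-]//|[_ h']].
  by congr Some; apply: Runiq h'.
have degR p q l : leNk p q -> leNook q m -> R p q l -> deg l = subNk q p.
  move=> pq qm [h1 h2]; apply: (@addNkI _ p).
  rewrite addNk_sub // -(df q) // -h2 deg_comp // df //.
  exact: leNook_trans qm.
have Rid p : R p p (src (f p)) by split; rewrite ?rng_src ?comp_idr.
exists x; first split.
- apply/seteqP; split=> [pq [l /xP[]]//|[p q] pqm].
  have [/= pq qm] := pqm; have [l /= h1 h2] := pf _ _ pq qm.
  by exists l; apply/xP.
- by move=> p q l /xP[[/= pq qm]]; exact: degR.
- move=> p q l /xP[[/= pq qm] [h1 h2]]; split; apply/xP; split.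
  + by split=> /=; [exact: leNk_refl|exact: leNook_trans qm].
  + by rewrite -h1; exact: Rid.
  + by split=> /=; [exact: leNk_refl|].
  + by rewrite -(src_comp h1) h2; exact: Rid.
- move=> p q r l l' /xP[[/= pq qm] [h1 h2]] /xP[[/= qr rm] [h3 h4]].
  apply/xP; split; first by split=> //=; exact: leNk_trans qr.
  have ll' : src l = rng l' by rewrite -h3 -h2 src_comp.
  by split=> /=; rewrite ?rng_comp // -compA // h2.
move=> p pm; apply/xP; split; first exact/Omega_oo0.
have f0p := pf _ _ (le0Nk p) pm.
(* Having degree 0, [f 0] is a unit; as a prefix of [f p] it is the range of [f p], so the value at
   [(0, p)] is [f p] itself. *)
have f00 : f 0 = rng (f p).
  have <- : rng (f 0) = f 0.
    by apply: deg0_rng; apply: df; apply: leNook_trans pm; exact: le0Nk.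
  by case: f0p => l /= h <-; rewrite rng_comp.
by split; rewrite /= f00 ?src_rng // comp_idl.
Qed.

Section Morphism.
Variables (m : Nook k) (x : kpath L).
Hypothesis xm : graph_morphism (Omega_oo m) x.

Lemma gm_dom : dom x = Omega_oo m. Proof. by case: xm. Qed.

Lemma gm_some p q : leNk p q -> leNook q m -> exists l, x (p, q) = Some l.
Proof. by move=> pq qm; have : dom x (p, q) by rewrite gm_dom. Qed.

Lemma gm_inv p q l : x (p, q) = Some l -> leNk p q /\ leNook q m.
Proof. by move=> e; have : dom x (p, q) by [exists l]; rewrite gm_dom. Qed.

Lemma gm_deg p q l : x (p, q) = Some l -> deg l = subNk q p.
Proof. by case: xm => _ + _ _; apply. Qed.

Lemma gm_deg0 p l : x (0, p) = Some l -> deg l = p.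
Proof. by move=> /gm_deg ->; degrees. Qed.

Lemma gm_id p q l : x (p, q) = Some l ->
  x (p, p) = Some (rng l) /\ x (q, q) = Some (src l).
Proof. by case: xm => _ _ + _; apply. Qed.

Lemma gm_composable p q r a b : x (p, q) = Some a -> x (q, r) = Some b ->
  src a = rng b.
Proof. by move=> /gm_id[_ +] /gm_id[+ _] => -> []. Qed.

Lemma gm_comp p q r a b : x (p, q) = Some a -> x (q, r) = Some b ->
  x (p, r) = Some (comp a b).
Proof. by case: xm => _ _ _; apply. Qed.

Lemma gm_split p q l : leNk p q -> x (0, q) = Some l ->
  exists a b, [/\ x (0, p) = Some a, x (p, q) = Some b, src a = rng b
                & l = comp a b].
Proof.
move=> pq xq; have [_ qm] := gm_inv xq.
have [a xa] := gm_some (le0Nk p) (leNook_trans pq qm).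
have [b xb] := gm_some pq qm.
exists a, b; split=> //; first exact: gm_composable xa xb.
by have := gm_comp xa xb; rewrite xq => -[].
Qed.

Lemma gm_principal p q a l : leNk p q -> x (0, p) = Some a ->
  x (0, q) = Some l -> principal a l.
Proof.
move=> pq xp xq; have [a' [b [+ _ ab ->]]] := gm_split pq xq.
rewrite xp => -[->]; exact: principal_comp.
Qed.

Lemma gm_prefix q a l : x (0, q) = Some l -> principal a l ->
  x (0, deg a) = Some a.
Proof.
move=> xq al; have := principal_deg al; rewrite (gm_deg0 xq) => aq.
have [a' [b [xa _ a'b lE]]] := gm_split aq xq.
have a'l : principal a' l by rewrite lE; exact: principal_comp.
by rewrite xa (principal_anti a'l al) // (gm_deg0 xa).
Qed.

Lemma gm_factor p q a b : x (0, q) = Some (comp a b) -> src a = rng b ->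
  deg a = p -> x (0, p) = Some a /\ x (p, q) = Some b.
Proof.
move=> xq ab <-; have /principal_deg aq := principal_comp ab.
rewrite (gm_deg0 xq) in aq.
have [a' [b' [xa xb a'b' e]]] := gm_split aq xq.
have [ea eb] := factor_inj ab a'b' (esym (gm_deg0 xa)) e.
by rewrite {2}ea eb.
Qed.

Lemma gm_shift p : leNook p m -> graph_morphism (Omega_oo (subNook m p)) (shift x p).
Proof.
move=> pm; split.
- have -> : dom (shift x p) = [set pq | dom x (p + pq.1, p + pq.2)] by [].
  rewrite gm_dom; apply/seteqP; split=> -[q r] /= [/= qr rm]; split=> /=.
  + by degrees.
  + exact/leNook_sub.
  + by degrees.
  + exact/leNook_sub.
- by move=> q r l /gm_deg ->; degrees.
- by move=> q r l /gm_id.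
- by move=> q r s l l'; exact: gm_comp.
Qed.

Lemma deg_YeeE : deg_Yee x = m.
Proof.
apply: xget_unique => /=; first exact: gm_dom.
by move=> m' /esym; rewrite gm_dom => /Omega_oo_inj.
Qed.

End Morphism.

(** The value at [(p, q)] is the second factor of the initial segment of degree [q], the first
    factor having degree [p]. *)
Lemma gm_ext m x y : graph_morphism (Omega_oo m) x ->
  graph_morphism (Omega_oo m) y ->
  (forall p, leNook p m -> x (0, p) = y (0, p)) -> x = y.
Proof.
move=> xm ym xy; apply/funext => -[p q].
case: (pselect (Omega_oo m (p, q))) => [[/= pq qm]|pqm].
  have [l xl] := gm_some xm (le0Nk q) qm.
  have [a [b [xa -> ab lE]]] := gm_split xm pq xl.
  have [a' [b' [ya -> a'b' l'E]]] := gm_split ym pq (etrans (esym (xy _ qm)) xl).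
  have da : deg a = deg a'.
    by rewrite (gm_deg0 ym ya) (gm_deg0 xm xa).
  by have [_ ->] := factor_inj ab a'b' da (etrans (esym lE) l'E).
case xE: (x (p, q)) => [l|].
  by case: pqm; exact: gm_inv xE.
case yE: (y (p, q)) => [l|//].
by case: pqm; exact: gm_inv yE.
Qed.
Lemma shift_shift x p q : shift (shift x p) q = shift x (p + q).
Proof. by apply/funext => pq; rewrite /shift /= !addrA. Qed.

Lemma shiftE x p q : shift x p (0, q) = x (p, p + q).
Proof. by rewrite /shift /= addr0. Qed.

Lemma X_le_deg x p : X_Yee x -> leNook p (deg_Yee x) <-> dom x (0, p).
Proof. by move=> [m xm]; rewrite (deg_YeeE xm) (gm_dom xm) Omega_oo0. Qed.

Lemma X_shift x p : X_Yee x -> dom x (0, p) -> X_Yee (shift x p).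
Proof.
move=> [m xm]; rewrite (gm_dom xm) Omega_oo0 => pm.
by exists (subNook m p); exact: gm_shift.
Qed.

Lemma X_join x p q : X_Yee x -> dom x (0, p) -> dom x (0, q) ->
  dom x (0, joinNk p q).
Proof.
by move=> [m xm]; rewrite (gm_dom xm) !Omega_oo0; exact: leNook_join.
Qed.

(** Up to the join of [q] and [p] both paths consist of [c] followed by the same segment of the
    common tail, so their prefixes of degree [q] coincide. *)
Lemma X_ext_shift x y p c : X_Yee x -> X_Yee y ->
  x (0, p) = Some c -> y (0, p) = Some c -> shift x p = shift y p -> x = y.
Proof.
move=> [m xm] [m' ym] xp yp sxy.
have [_ pm] := gm_inv xm xp; have [_ pm'] := gm_inv ym yp.
(* The tails have equal domains, and subtracting the finite degree [p], which lies below both [m]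
   and [m'], can be undone. *)
have mm' : m = m'.
  have : subNook m p = subNook m' p.
    apply: Omega_oo_inj.
    by rewrite -(gm_dom (gm_shift xm pm)) sxy (gm_dom (gm_shift ym pm')).
  move=> /ffunP e; apply/ffunP => i.
  move: (e i) (pm i) (pm' i); rewrite !ffunE.
  by case: (m i) (m' i) => [a|] [b|] //= [ab] ??; congr Some; lia.
rewrite -{}mm' in ym.
apply: (gm_ext xm ym) => q qm.
have jm : leNook (joinNk q p) m by exact: leNook_join.
have pj : leNk p (joinNk q p) by exact: leNk_joinr.
have qj : leNk q (joinNk q p) by exact: leNk_joinl.
have [u xu] := gm_some xm pj jm.
have yu : y (p, joinNk q p) = Some u.
  by rewrite -(addNk_sub pj) -shiftE -sxy shiftE addNk_sub.
have [a [b [xa _ ab e]]] := gm_split xm qj (gm_comp xm xp xu).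
have [a' [b' [ya _ ab' e']]] := gm_split ym qj (gm_comp ym yp yu).
rewrite xa ya; congr Some.
have [||//] := factor_inj ab ab'; last by rewrite -e.
by rewrite (gm_deg0 xm xa) (gm_deg0 ym ya).
Qed.

(* [shift x (p + r) = shift y (q + r)] only says that [x] and [y] eventually
   agree; the common segment [c] of degree [r] moves the agreement back. *)
Lemma shift_eq_back x y p q r c : X_Yee x -> X_Yee y ->
  x (p, p + r) = Some c -> y (q, q + r) = Some c ->
  shift x (p + r) = shift y (q + r) -> shift x p = shift y q.
Proof.
move=> Xx Xy xc yc sxy.
have dm z n l : X_Yee z -> z (n, n + r) = Some l -> dom z (0, n).
  move=> [m zm] zl; have [_ nm] := gm_inv zm zl.
  rewrite (gm_dom zm) Omega_oo0; apply: leNook_trans nm; exact: leNk_addr.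
apply: (@X_ext_shift _ _ r c).
- by apply: X_shift => //; exact: dm xc.
- by apply: X_shift => //; exact: dm yc.
- by rewrite shiftE.
- by rewrite shiftE.
- by rewrite !shift_shift.
Qed.

(** * The operations [sigma] and [concat] *)

Lemma the_path_unique (P : set (kpath L)) x :
  P x -> (forall y, P y -> y = x) -> the_path P = x.
Proof. exact: (@xget_unique {classic kpath L}). Qed.

Lemma sigmaE x p : X_Yee x -> dom x (0, p) -> sigma p x = shift x p.
Proof.
move=> [m xm]; rewrite (gm_dom xm) Omega_oo0 => pm.
have sm := gm_shift xm pm.
apply: the_path_unique => /=; rewrite (deg_YeeE xm).
  by split=> // n _; exact: shiftE.
by move=> y [ym yE]; apply: (gm_ext ym sm) => n nm; rewrite yE // shiftE.
Qed.

(** The prefix [e p], of degree [joinNk p (deg l)], must be [l] followed by an initial segment of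
    [x]. Cutting it back to degree [p] gives a compatible family [f], and [path_of_prefixes]
    applies. *)
Lemma concat_ex l x : X_Yee x -> x (0, 0) = Some (src l) ->
  exists2 y, graph_morphism (Omega_oo (addNook (deg l) (deg_Yee x))) y &
    y (0, deg l) = Some l /\ shift y (deg l) = x.
Proof.
move=> [m xm] x0; rewrite (deg_YeeE xm); set M := addNook _ _.
pose rest p : Nk k := subNk (joinNk p (deg l)) (deg l).
have rest_le p : leNook p M -> leNook (rest p) m by rewrite /rest /M => pM; degrees.
(* Outside the domain [M] the value [l] is only a default, here and for [f]. *)
have /choice[e eP] : forall p, exists e, leNook p M ->
    exists u, [/\ x (0, rest p) = Some u, src l = rng u & e = comp l u].
  move=> p; case: (pselect (leNook p M)) => [/rest_le pm|pM]; last by exists l.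
  have [u xu] := gm_some xm (le0Nk _) pm.
  exists (comp l u) => _; exists u; split=> //.
  by have [] := gm_id xm xu; rewrite x0 => -[].
have de p : leNook p M -> deg (e p) = joinNk p (deg l).
  move=> /eP[u [xu lu ->]]; rewrite deg_comp // (gm_deg0 xm xu) addNk_sub //.
  exact: leNk_joinr.
have /choice[f fP] : forall p, exists a, leNook p M ->
    principal a (e p) /\ deg a = p.
  move=> p; case: (pselect (leNook p M)) => [pM|?]; last by exists l.
  have [|a ae da] := @prefix_ex _ _ (e p) p; last by exists a.
  by rewrite de //; exact: leNk_joinl.
have e_le p q : leNk p q -> leNook q M -> principal (e p) (e q).
  move=> pq qM; have pM := leNook_trans pq qM.
  have [u [xu lu ->]] := eP _ pM; have [v [xv lv ->]] := eP _ qM.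
  have [|w /= uw vE] := gm_principal xm _ xu xv; first by rewrite /rest; degrees.
  by exists w; rewrite /= ?src_comp // compA // vE.
have [||y ym yf] := @path_of_prefixes M f.
- by move=> p /fP[].
- move=> p q pq qM; have pM := leNook_trans pq qM.
  have [fp dp] := fP _ pM; have [fq dq] := fP _ qM.
  apply: principal_total fq _; last by rewrite dp dq.
  by apply: principal_trans fp _; exact: e_le.
exists y => //.
have lM : leNook (deg l) M by rewrite /M; degrees.
have lf : f (deg l) = l.
  have [fl dl] := fP _ lM; apply: principal_anti fl _ dl.
  by have [u [_ lu ->]] := eP _ lM; exact: principal_comp.
split; first by rewrite yf // lf.
have Mm : subNook M (deg l) = m.
  by apply/ffunP => i; rewrite !ffunE; case: (m i) => //= a; rewrite addKn.
have sm : graph_morphism (Omega_oo m) (shift y (deg l)).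
  by rewrite -Mm; exact: gm_shift.
apply: (gm_ext sm xm) => p pm.
have pM : leNook (deg l + p) M.
  by move=> i; move: (pm i); rewrite !ffunE; case: (m i) => //= a; lia.
rewrite shiftE; have [u [xu lu eE]] := eP _ pM.
have rp : rest (deg l + p) = p.
  by rewrite /rest; degrees.
rewrite rp in xu; rewrite xu.
have yE : y (0, deg l + p) = Some (comp l u).
  rewrite yf // -eE; congr Some.
  have [fl dl] := fP _ pM; apply: principal_anti fl (principal_refl _) _.
  by rewrite dl de //; degrees.
by have [_ ->] := gm_factor ym yE lu erefl.
Qed.

Lemma concatP l x : X_Yee x -> x (0, 0) = Some (src l) ->
  [/\ X_Yee (concat l x), concat l x (0, deg l) = Some l
    & shift (concat l x) (deg l) = x].
Proof.
move=> Xx x0; have [y ym [yl yx]] := concat_ex Xx x0.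
have Xy : X_Yee y by exists (addNook (deg l) (deg_Yee x)).
suff -> : concat l x = y by [].
apply: the_path_unique => /=.
  by split=> //; rewrite sigmaE //; exists l.
move=> y' [ym' yl']; have Xy' : X_Yee y' by exists (addNook (deg l) (deg_Yee x)).
rewrite sigmaE //; last by exists l.
by move=> yx'; apply: (X_ext_shift Xy' Xy yl' yl); rewrite yx yx'.
Qed.

Lemma concat_shift l y p : X_Yee y -> y (0, p) = Some l ->
  concat l (shift y p) = y.
Proof.
move=> Xy yl; have [m ym] := Xy.
have y0 : shift y p (0, 0) = Some (src l).
  by rewrite shiftE addr0; have [] := gm_id ym yl.
have Xs : X_Yee (shift y p) by apply: X_shift => //; exists l.
have [Xc cl cs] := concatP Xs y0.
rewrite (gm_deg0 ym yl) in cl cs.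
exact: X_ext_shift Xc Xy cl yl cs.
Qed.

End Paths.

(** * Basic neighbourhoods and the common underlying set *)

Section Topology.
Variables (k : nat) (L : kgraph k).
Implicit Types (x y z : kpath L) (l mu nu e a b c : L) (p q r m n : Nk k).

Lemma topology_with_basis_sub T (B B' : set (set T)) :
  (forall U g, B U -> U g -> exists V, [/\ B' V, V g & V `<=` U]) ->
  topology_with_basis B `<=` topology_with_basis B'.
Proof.
move=> BB' O [C CB <-].
(* Taking every member of [B'] inside the open set avoids choosing a neighbourhood for each
   point. *)
exists [set V | B' V /\ V `<=` \bigcup_(U in C) U]; first by move=> V [].
apply/seteqP; split=> g; first by move=> [V [_ VO] /VO].
move=> [U CU Ug]; have [V [B'V Vg VU]] := BB' _ _ (CB _ CU) Ug.
by exists V => //; split=> // h /VU Uh; exists U.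
Qed.

Lemma basis_open T (B : set (set T)) U : B U -> topology_with_basis B U.
Proof. by move=> BU; exists [set U]; [move=> V ->|rewrite bigcup_set1]. Qed.

Definition prefixes x : set L := [set l | exists m, x (0, m) = Some l].

Definition cylinder (K1 K2 : set L) : set (kpath L) :=
  [set x | [/\ X_m x, K1 `<=` prefixes x & prefixes x `<=` ~` K2]].

Lemma cylinder_open (K1 K2 : set L) : finite_set K1 -> finite_set K2 ->
  X_m_open (cylinder K1 K2).
Proof. by move=> fK1 fK2; apply: basis_open; exists K1, K2. Qed.

Lemma X_m_open_nbhd (U : set (kpath L)) x : X_m_open U -> U x ->
  exists K1 K2, [/\ finite_set K1, finite_set K2, cylinder K1 K2 x
    & cylinder K1 K2 `<=` U].
Proof.
move=> [C CB <-] [Z CZ Zx]; have [K1 [K2 [fK1 fK2 ZE]]] := CB _ CZ.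
exists K1, K2; split=> //; first by move: Zx; rewrite ZE.
by move=> y Ky; exists Z => //; rewrite ZE.
Qed.

Lemma prefixesP x l : X_Yee x -> prefixes x l <-> x (0, deg l) = Some l.
Proof.
move=> [m xm]; split=> [[p xp]|xl]; last by exists (deg l).
by rewrite (gm_deg0 xm xp).
Qed.

Lemma G_set_eq : @G_m_set k L = @G_Yee_set k L.
Proof.
apply/seteqP; split=> g [x [y [m [n]]]].
  move=> [-> [Xx Xy] xm yn sxy]; rewrite X_m_Yee in Xx Xy.
  by exists x, y, m, n; split; rewrite ?sigmaE //; apply/X_le_deg.
move=> [-> [Xx Xy]] /(X_le_deg _ Xx) xm /(X_le_deg _ Xy) yn.
by rewrite !sigmaE // => sxy; exists x, y, m, n; rewrite X_m_Yee.
Qed.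

(* [(x, deg l - deg mu, y)] has the form [(l z, deg l - deg mu, mu z)]. *)
Definition tails_agree x y l mu :=
  [/\ x (0, deg l) = Some l, y (0, deg mu) = Some mu
    & shift x (deg l) = shift y (deg mu)].

Lemma tails_agree_src x y l mu : X_Yee x -> X_Yee y ->
  tails_agree x y l mu -> src l = src mu.
Proof.
move=> [m xm] [n yn] [/(gm_id xm)[_ xl] /(gm_id yn)[_ ymu] sxy].
have := congr1 (fun z => z (0, 0)) sxy.
by rewrite !shiftE !addr0 xl ymu => -[].
Qed.

(** The path [z] in [(l z, mu z)] is recovered as the common tail. The inclusion of [F] in the fibre
    product ensures that [mu z] is meaningful. *)
Lemma Z_YeeP F (d : Zk k) x (d' : Zk k) y : F `<=` fibre_prod setT setT ->
  Z_Yee F d (x, d', y) <-> [/\ d = d', X_Yee x, X_Yee y &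
    exists l mu, [/\ F (l, mu), diffZk (deg l) (deg mu) = d
      & tails_agree x y l mu]].
Proof.
move=> Ffib; split.
  move=> [l [mu [z [Flm dlm Xz z0 [-> -> ->]]]]].
  have [_ _ /= slm] := Ffib _ Flm.
  have [Xl zl sl] := concatP Xz z0.
  have [|Xmu zmu smu] := @concatP _ _ mu _ Xz; first by rewrite z0 slm.
  by split=> //; exists l, mu; split=> //; split=> //; rewrite sl smu.
move=> [<- Xx Xy [l [mu [Flm dlm [xl ymu sxy]]]]].
have [m xm] := Xx.
exists l, mu, (shift x (deg l)); split=> //.
- by apply: X_shift => //; exists l.
- by rewrite shiftE addr0; have [] := gm_id xm xl.
- by rewrite dlm {2}sxy !concat_shift.
Qed.

(** A segment [nu] read in [x] after [l] is read in [y] after [mu] too. Thus a condition on a prefix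
    of one path becomes a condition on a pair. *)
Lemma tails_agree_comp x y l mu nu : X_Yee x -> X_Yee y ->
  tails_agree x y l mu -> src l = rng nu ->
  x (0, deg (comp l nu)) = Some (comp l nu) ->
  tails_agree x y (comp l nu) (comp mu nu).
Proof.
move=> Xx Xy xy lnu xln; have slm := tails_agree_src Xx Xy xy.
have munu : src mu = rng nu by rewrite -slm.
have [[m xm] [n yn]] := (Xx, Xy); have [xl ymu sxy] := xy.
have [_ xnu] := gm_factor xm xln lnu erefl.
have ynu : y (deg mu, deg mu + deg nu) = Some nu.
  by rewrite -shiftE -sxy shiftE -deg_comp.
split=> //; rewrite !deg_comp //; first exact: (gm_comp yn ymu ynu).
by rewrite -!shift_shift sxy.
Qed.

Lemma tails_agree_sym x y l mu : tails_agree x y l mu -> tails_agree y x mu l.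
Proof. by case. Qed.

(** * Comparison of the two topologies *)

Lemma common_extensions (L_fa : finitely_aligned L) l (K : set L) :
  finite_set K -> exists N : set L, [/\ finite_set N,
    forall nu, N nu -> src l = rng nu /\ exists2 e, K e & principal e (comp l nu)
  & forall e c, K e -> principal l c -> principal e c ->
      exists2 nu, N nu & principal (comp l nu) c].
Proof.
move=> fK; have /choice[J JP] := L_fa l.
(* Finite alignment of [l] with each [e] gives the finite set [J e]; [N] collects the remainders
   after [l] of its members. *)
exists (\bigcup_(e in K) [set nu | src l = rng nu /\ J e (comp l nu)]); split.
- apply: bigcup_finite => // e Ke; have [fJ _] := JP e.
  (* By cancellation [nu] is recovered from [comp l nu], so finiteness passes from [J e] to the
     remainders; off [principal l] the value [l] is a default. *)
  have /choice[g gP] : forall a, exists nu, principal l a ->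
      src l = rng nu /\ comp l nu = a.
    move=> a; case: (pselect (principal l a)) => [[nu /= ? ?]|?]; last by exists l.
    by exists nu.
  apply: (sub_finite_set _ (finite_image g fJ)) => nu [lnu Jnu].
  exists (comp l nu) => //; have [h1 h2] := gP _ (principal_comp lnu).
  by have [] := factor_inj h1 lnu erefl h2.
- move=> nu [e Ke [lnu Jnu]]; split=> //; exists e => //.
  have [_ JE] := JP e.
  have : (principal l `&` principal e) (comp l nu).
    by rewrite JE; exists (comp l nu) => //; exact: principal_refl.
  by case.
- move=> e c Ke lc ec; have [_ JE] := JP e.
  have [a Ja ac] : (\bigcup_(a in J e) principal a) c by rewrite -JE.
  have [[nu /= lnu aE] _] : (principal l `&` principal e) a.
    by rewrite JE; exists a => //; exact: principal_refl.
  by exists nu; [exists e => //; split=> //|]; rewrite aE.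
Qed.

Lemma cylinder_avoids (K1 K2 : set L) x e a : cylinder K1 K2 x -> K2 e ->
  principal e a -> x (0, deg a) <> Some a.
Proof.
move=> [Xx _ xK2] K2e ea xa; rewrite X_m_Yee in Xx; have [m xm] := Xx.
by apply: (xK2 e) => //; apply/prefixesP => //; exact: (gm_prefix xm xa ea).
Qed.

(** Required prefixes of [x] are short enough to be prefixes of [l], hence of [y]. A forbidden
    prefix of [y] would have a common extension with [l] inside [y], so [y] would begin with
    [comp l nu] for some [nu] in [N]. *)
Lemma cylinder_transfer (K1 K2 N : set L) x y l : cylinder K1 K2 x -> X_Yee y ->
  x (0, deg l) = Some l -> y (0, deg l) = Some l ->
  (forall e, K1 e -> leNk (deg e) (deg l)) ->
  (forall e c, K2 e -> principal l c -> principal e c ->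
      exists2 nu, N nu & principal (comp l nu) c) ->
  (forall nu, N nu -> y (0, deg (comp l nu)) <> Some (comp l nu)) ->
  cylinder K1 K2 y.
Proof.
move=> [Xx xK1 _] Xy xl yl K1l Nl yN; rewrite X_m_Yee in Xx.
have [[m xm] [n yn]] := (Xx, Xy).
split; first by rewrite X_m_Yee.
  move=> e K1e; have /(prefixesP _ Xx) xe := xK1 _ K1e.
  apply/prefixesP => //; apply: (gm_prefix yn yl).
  exact: (gm_principal xm (K1l _ K1e) xe xl).
move=> e /(prefixesP _ Xy) ye K2e.
have [c yc] : dom y (0, joinNk (deg l) (deg e)).
  by apply: X_join => //; [exists l|exists e].
have [|||nu Nnu nuc] := Nl e c => //.
- by apply: (gm_principal yn _ yl yc); exact: leNk_joinl.
- by apply: (gm_principal yn _ ye yc); exact: leNk_joinr.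
by apply: (yN _ Nnu); exact: (gm_prefix yn yc nuc).
Qed.

(** Since [subNk] is truncated, [m + subNk (deg l) m] is the join of [m] and [deg l], and domains of
    paths are closed under joins. *)
Lemma dom_shift_sub x m l : X_Yee x -> dom x (0, m) -> prefixes x l ->
  dom (shift x m) (0, subNk (deg l) m).
Proof.
move=> Xx xm /(prefixesP _ Xx) xl; have [d xd] := Xx.
have := X_join Xx xm; move=> /(_ (deg l)) [|c xc]; first by exists l.
have [_ jd] := gm_inv xd xc.
rewrite (gm_dom (gm_shift xd _)); last first.
  by apply: leNook_trans jd; exact: leNk_joinl.
apply/Omega_oo0/leNook_sub; first by apply: leNook_trans jd; exact: leNk_joinl.
suff -> : m + subNk (deg l) m = joinNk m (deg l) by [].
by clear; degrees.
Qed.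

Lemma G_m_basis_nbhd (L_fa : finitely_aligned L) (Z : set (triple L)) g :
  G_m_basis Z -> Z g -> exists V, [/\ G_Yee_basis V, V g & V `<=` Z].
Proof.
move=> [m [n [U [W [oU oW ->]]]]] [x [y [-> _ [Ux Wy] [xm yn] sxy]]].
have [K1 [K2 [fK1 fK2 Kx KU]]] := X_m_open_nbhd oU Ux.
have [K1' [K2' [fK1' fK2' Ky KW]]] := X_m_open_nbhd oW Wy.
have [[Xx xK1 _] [Xy yK1 _]] := (Kx, Ky).
rewrite X_m_Yee in Xx; rewrite X_m_Yee in Xy.
have [[d xd] [d' yd]] := (Xx, Xy).
have Xs : X_Yee (shift x m) by exact: X_shift.
(* In the common tail, [r] dominates what the prefixes in [K1] need beyond [m] and those in [K1']
   beyond [n]. *)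
have [r /X_le_deg-/(_ Xs)[c sc] rP] : exists2 r, leNook r (deg_Yee (shift x m)) &
    forall p, ([set subNk (deg e) m | e in K1] `|`
               [set subNk (deg e) n | e in K1']) p -> leNk p r.
  apply: finite_sup; first by rewrite finite_setU; split; exact: finite_image.
  move=> p [] [e Ke <-]; apply/X_le_deg => //.
    exact: dom_shift_sub (xK1 _ Ke).
  by rewrite sxy; exact: dom_shift_sub (yK1 _ Ke).
have xc : x (m, m + r) = Some c by rewrite -shiftE.
have yc : y (n, n + r) = Some c by rewrite -shiftE -sxy.
have [[a xa] [b yb]] := (xm, yn).
have ac := gm_composable xd xa xc; have bc := gm_composable yd yb yc.
pose l := comp a c; pose mu := comp b c.
have xl : x (0, m + r) = Some l by exact: (gm_comp xd xa xc).
have ymu : y (0, n + r) = Some mu by exact: (gm_comp yd yb yc).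
have dl := gm_deg0 xd xl; have dmu := gm_deg0 yd ymu.
have xy : tails_agree x y l mu.
  by split; rewrite ?dl ?dmu // -!shift_shift sxy.
have slm := tails_agree_src Xx Xy xy.
have [N [fN NK2 Nl]] := common_extensions L_fa l fK2.
have [N' [fN' NK2' Nmu]] := common_extensions L_fa mu fK2'.
(* Both continuations that force a prefix from [K2] on the first path and those that force one from
   [K2'] on the second are removed. *)
pose F := [set (comp l nu, comp mu nu) | nu in N `|` N'].
have Nsrc nu : (N `|` N') nu -> src l = rng nu.
  by case=> [/NK2[]//|/NK2'[+ _]]; rewrite slm.
have Ffib : F `<=` fibre_prod setT setT.
  move=> _ [nu /Nsrc lnu <-]; split=> //=.
  have munu : src mu = rng nu by rewrite -slm.
  by rewrite (src_comp lnu) (src_comp munu).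
have lmfib : fibre_prod [set l] [set mu] `<=` fibre_prod setT setT.
  by move=> ? [].
exists (Z_Yee (fibre_prod [set l] [set mu]) (diffZk m n) `\` Z_Yee F (diffZk m n)).
split.
- exists (diffZk m n), [set l], [set mu], F; split=> //.
  by apply: finite_image; rewrite finite_setU.
- split.
    apply/Z_YeeP => //; split=> //; exists l, mu; split=> //.
    by rewrite dl dmu; apply/diffZk_eq; clear; degrees.
  move=> /(Z_YeeP _ _ _ _ Ffib)[_ _ _ [l' [mu' [[nu Nnu [<- <-]] _ [xln ymn _]]]]].
  case: Nnu => [/NK2|/NK2'] [_ [e Ke eP]].
    exact: cylinder_avoids Kx Ke eP xln.
  exact: cylinder_avoids Ky Ke eP ymn.
- move=> [[x' q] y'] [/(Z_YeeP _ _ _ _ lmfib)[<- Xx' Xy' [l' [mu' [[/= -> -> _] _ xy']]]]].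
  move=> nF; have [[e xe'] [e' ye']] := (Xx', Xy').
  have [x'l y'mu sxy'] := xy'.
  have nN nu : (N `|` N') nu ->
      ~ tails_agree x' y' (comp l nu) (comp mu nu).
    move=> Nnu h; apply: nF; apply/Z_YeeP => //; split=> //.
    have lnu := Nsrc _ Nnu.
    exists (comp l nu), (comp mu nu); split=> //; first by exists nu.
    have munu : src mu = rng nu by rewrite -slm.
    rewrite (deg_comp lnu) (deg_comp munu) dl dmu.
    by apply/diffZk_eq; clear; degrees.
  have [x'a x'c] := gm_factor xe' x'l ac (gm_deg0 xd xa).
  have [y'b y'c] := gm_factor ye' y'mu bc (gm_deg0 yd yb).
  rewrite dl in x'c sxy'; rewrite dmu in y'c sxy'.
  (* The tails agree after degrees [m + r] and [n + r]; the shared segment [c] moves the agreement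
     back to [m] and [n]. *)
  have s' := shift_eq_back Xx' Xy' x'c y'c sxy'.
  exists x', y'; split=> //.
  + exists x', y', m, n; split; rewrite ?X_m_Yee //; [by exists a|by exists b].
  + split.
      apply/KU/(cylinder_transfer Kx Xx' _ x'l _ Nl); first by rewrite dl.
        move=> u K1u; have : leNk (subNk (deg u) m) r by apply: rP; left; exists u.
        by rewrite dl; clear => h; degrees.
      (* If [x'] began with [comp l nu], then [y'] would begin with [comp mu nu], which puts the
         triple in the removed set. *)
      move=> nu Nnu x'nu; apply: (nN nu); first by left.
      by apply: tails_agree_comp => //; apply: Nsrc; left.
    apply/KW/(cylinder_transfer Ky Xy' _ y'mu _ Nmu); first by rewrite dmu.
      move=> u K1u; have : leNk (subNk (deg u) n) r by apply: rP; right; exists u.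
      by rewrite dmu; clear => h; degrees.
    move=> nu Nnu y'nu; apply: (nN nu); first by right.
    apply/tails_agree_sym/tails_agree_comp => //; first exact: tails_agree_sym.
    by rewrite -slm; apply: Nsrc; right.
  + by split; [exists a|exists b].
Qed.

(* A neighbourhood of [x] whose members have a prefix in [E] only if [x] has it,
   and then agree with [x] up to the join of that prefix with [l]. *)
Definition separating_cylinder x l (E : set L) : set (kpath L) :=
  cylinder ([set odflt l (x (0, joinNk (deg l) (deg a))) | a in E] `|` [set l])
           (E `&` [set a | ~ prefixes x a]).

Lemma separating_cylinder_open x l (E : set L) : finite_set E ->
  X_m_open (separating_cylinder x l E).
Proof.
move=> fE; apply: cylinder_open; last by apply: sub_finite_set fE => ? [].
by rewrite finite_setU; split; [exact: finite_image|exact: finite_set1].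
Qed.

Lemma separating_cylinder_mem x l (E : set L) : X_Yee x -> prefixes x l ->
  separating_cylinder x l E x.
Proof.
move=> Xx xl; split; first by rewrite X_m_Yee.
  move=> c [[a _ <-]|->//]; case xE: (x _) => [u|//].
  by exists (joinNk (deg l) (deg a)).
by move=> a xa [].
Qed.

Lemma separating_cylinder_prefix x y l (E : set L) : separating_cylinder x l E y ->
  prefixes y l.
Proof. by move=> [_ + _]; apply; right. Qed.

Lemma separating_cylinder_agree x y l (E : set L) a :
  X_Yee x -> prefixes x l -> separating_cylinder x l E y -> E a ->
  y (0, deg a) = Some a ->
  exists c, [/\ x (0, deg a) = Some a,
    x (deg a, joinNk (deg l) (deg a)) = Some c &
    y (deg a, joinNk (deg l) (deg a)) = Some c].
Proof.
move=> Xx xl [Xy yK1 yK2] Ea ya; rewrite X_m_Yee in Xy.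
have xa : x (0, deg a) = Some a.
  apply/prefixesP => //; apply: contrapT => nxa.
  by apply: (yK2 a) => //; exists (deg a).
have [[m xm] [n yn]] := (Xx, Xy).
have [w xw] : dom x (0, joinNk (deg l) (deg a)).
  by apply: X_join => //; [exists l; exact/prefixesP|exists a].
have yw : y (0, joinNk (deg l) (deg a)) = Some w.
  rewrite -(gm_deg0 xm xw); apply/prefixesP => //; apply: yK1; left.
  by exists a => //; rewrite xw.
have [a' [c [xa' xc a'c wE]]] := gm_split xm (leNk_joinr _ _) xw.
move: xa'; rewrite xa => -[aE]; rewrite -aE in a'c wE.
exists c; split=> //.
by rewrite wE in yw; have [] := gm_factor yn yw a'c erefl.
Qed.

(** A pair [(l, mu)] witnessing membership supplies the degrees, and [U] and [W] separate from [F]: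
    if nearby paths agreed after some [(a, b)] in [F], then so would [x] and [y]. *)
Lemma G_Yee_basis_nbhd (Z : set (triple L)) g :
  G_Yee_basis Z -> Z g -> exists V, [/\ G_m_basis V, V g & V `<=` Z].
Proof.
case: g => [[x d'] y] [d [A [B [F [fF Ffib ->]]]]].
have ABfib : fibre_prod A B `<=` fibre_prod setT setT by move=> ? [].
move=> [/(Z_YeeP _ _ _ _ ABfib)[<- Xx Xy [l [mu [ABlm dlm xy]]]] nF].
have [xl ymu sxy] := xy.
have Xmx : X_m x by rewrite X_m_Yee.
have Xmy : X_m y by rewrite X_m_Yee.
have pl : prefixes x l by exists (deg l).
have pmu : prefixes y mu by exists (deg mu).
pose U := separating_cylinder x l (fst @` F).
pose W := separating_cylinder y mu (snd @` F).
exists [set g | exists x y, [/\ g = (x, diffZk (deg l) (deg mu), y),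
              G_m_set g, U x /\ W y,
              dom x (0, deg l) /\ dom y (0, deg mu)
            & shift x (deg l) = shift y (deg mu)]]; split.
- exists (deg l), (deg mu), U, W; split=> //;
    by apply: separating_cylinder_open; exact: finite_image.
- exists x, y; split=> //; first by rewrite dlm.
  + by exists x, y, (deg l), (deg mu); split; rewrite ?dlm //; [exists l|exists mu].
  + by split; exact: separating_cylinder_mem.
  + by split; [exists l|exists mu].
move=> _ [x' [y' [-> _ [Ux' Wy'] _ sxy']]].
have [Xx' _ _] := Ux'; have [Xy' _ _] := Wy'.
rewrite X_m_Yee in Xx'; rewrite X_m_Yee in Xy'.
have /(prefixesP _ Xx') x'l := separating_cylinder_prefix Ux'.
have /(prefixesP _ Xy') y'mu := separating_cylinder_prefix Wy'.
split; first by apply/Z_YeeP => //; split=> //; exists l, mu.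
move=> /(Z_YeeP _ _ _ _ Ffib)[_ _ _ [a [b [Fab dab [x'a y'b sab]]]]].
apply: nF; apply/Z_YeeP => //; split=> //; exists a, b; split=> //.
have [|c [xa xc x'c]] := separating_cylinder_agree Xx pl Ux' _ x'a.
  by exists (a, b).
have [|c' [yb yc y'c]] := separating_cylinder_agree Xy pmu Wy' _ y'b.
  by exists (a, b).
have /diffZk_eq deg_eq : diffZk (deg a) (deg b) = diffZk (deg l) (deg mu).
  by rewrite dab.
(* [s] and [r] complete [deg a] and [deg l] to their join. As the degree differences of [(a, b)] and
   [(l, mu)] are equal, they also complete [deg b] and [deg mu] to theirs. *)
pose s := subNk (joinNk (deg l) (deg a)) (deg a).
pose r := subNk (joinNk (deg l) (deg a)) (deg l).
have aj : joinNk (deg l) (deg a) = deg a + s by clear; rewrite /s; degrees.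
have bs : joinNk (deg mu) (deg b) = deg b + s.
  by move: deg_eq; clear; rewrite /s => e; degrees.
have lr : deg a + s = deg l + r by clear; rewrite /s /r; degrees.
have mr : deg b + s = deg mu + r.
  by move: deg_eq; clear; rewrite /s /r => e; degrees.
rewrite aj in xc x'c; rewrite bs in yc y'c.
(* Beyond the joins [x] and [y] agree since their tails after [l] and [mu] do. On the stretch of
   degree [s] both carry [c]: [y] matches [y'], which matches [x'], which matches [x]. *)
split=> //; apply: (shift_eq_back Xx Xy xc).
  by rewrite yc -y'c -shiftE -sab shiftE x'c.
by rewrite lr mr -!shift_shift sxy.
Qed.

(** The operations are given by the same formulas on the same set, so only the topologies need
    comparison. *)
Lemma G_m_eq_G_Yee (L_fa : finitely_aligned L) : G_m L = G_Yee L.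
Proof.
rewrite /G_m /G_Yee G_set_eq; congr TGroupoid.
apply/seteqP; split; apply: topology_with_basis_sub => U g.
  exact: G_m_basis_nbhd.
exact: G_Yee_basis_nbhd.
Qed.

End Topology.

Theorem mainTheorem4 (k : nat) (k_gt0 : (0 < k)%N) (L : kgraph k)
    (L_fa : finitely_aligned L) :
  G_m L = G_Yee L /\ boundary_G_m L = boundary_G_Yee L.
Proof.
have GE := G_m_eq_G_Yee L_fa; split=> //.
by rewrite /boundary_G_m /boundary_G_Yee GE X_m_Yee.
Qed.
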